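(* Let $U\subseteq D$ be an open set having an accumulation point $\zeta\in S$ with $\operatorname{Im}\zeta\neq 0$. Then for generic $\bm{\lambda}=(\lambda_n)_{n=0}^{\infty}\in\Omega$, the image $f_{\bm{\lambda}}(U)$ is a dense and open subset of $\mathbb{C}$.
   Context: $D=\{z\in\mathbb{C}:|z|<1\}$ is the open unit disk and $S=\{z\in\mathbb{C}:|z|=1\}$ is the unit circle. $\Lambda\subseteq\mathbb{C}$ is a bounded set with at least two elements, endowed with the subspace topology, and $\Omega=\Omega_\Lambda:=\prod_{n=0}^{\infty}\Lambda$ carries the product topology; it is assumed throughout that $\Omega$ is a Baire space. For $\bm{\lambda}=(\lambda_n)_{n=0}^\infty\in\Omega$, $f_{\bm{\lambda}}(z):=\sum_{n=0}^\infty\lambda_n z^n$, which is holomorphic in $D$. A property holds ''for generic $\bm{\lambda}\in\Omega$'' if the set of $\bm{\lambda}\in\Omega$ for which it holds is residual (its complement is meager) in $\Omega$. *)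

(* Defs.v *)
From HB Require Import structures.
From mathcomp Require Import all_boot all_order all_algebra.
From mathcomp Require Import complex.
From mathcomp Require Import all_classical all_reals all_analysis.

Set Implicit Arguments.
Unset Strict Implicit.
Unset Printing Implicit Defensive.

Import Order.TTheory GRing.Theory Num.Theory.
Import numFieldNormedType.Exports.

Local Open Scope classical_set_scope.
Local Open Scope ring_scope.

(* The topology that numFieldNormedType.Exports puts on a numClosedFieldType is
   keyed on the structure projection, so it is not found on a bare [R[i]]:
   [Cplx R] is [R[i]] seen through that projection.  Its norm takes its values
   in [R[i]] itself, which is why bounds and radii below are complex numbers
   (comparable to 0, hence real). *)
Definition Cplx (R : realType) : numClosedFieldType := R[i].

Section Category.
Variable T : topologicalType.
Implicit Types A : set T.

Definition nowhere_dense A := interior (closure A) = set0.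

Definition meager A := exists2 F : (set T)^nat,
  (forall n, nowhere_dense (F n)) & A = \bigcup_n F n.

Definition residual A := meager (~` A).

Definition Baire_space := forall F : (set T)^nat,
  (forall n, open (F n) /\ dense (F n)) -> dense (\bigcap_n F n).

End Category.

Arguments Baire_space : clear implicits.

Definition generic (T : topologicalType) (P : T -> Prop) : Prop :=
  residual [set x | P x].

Section PowerSeries.
Variable R : realType.
Local Notation C := (Cplx R).

Definition unit_disk : set C := [set z | `|z| < 1].

Definition unit_circle : set C := [set z | `|z| = 1].

(* [set_type L] carries the subspace topology of [L] (the initial topology of
   the inclusion). *)
Definition Omega (L : set C) : topologicalType :=
  prod_topology (fun _ : nat => set_type L).

(* [lim] is a total operator; for bounded [L] the series converges for every
   [z] in [unit_disk], the only points where [fser lambda] is meant to be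
   used. *)
Definition fser (L : set C) (lambda : Omega L) (z : C) : C :=
  limn (series (fun n => set_val (lambda n) * z ^+ n)).

End PowerSeries.

Arguments unit_disk : clear implicits.
Arguments unit_circle : clear implicits.

(* Main.v *)
Require Import Defs.
From mathcomp Require Import all_boot all_order all_algebra.
From mathcomp Require Import complex.
From mathcomp Require Import all_classical all_reals all_analysis.
From mathcomp Require Import lra ring.
Import Order.TTheory GRing.Theory Num.Theory.
Import numFieldNormedType.Exports.
Local Open Scope classical_set_scope.
Local Open Scope ring_scope.

Set Implicit Arguments.
Unset Strict Implicit.
Unset Printing Implicit Defensive.

(** The theorem rests on two countable families of open dense conditions on
    the digit sequence [lam]; a sequence satisfying all of them has a dense and
    open image.

    Density of the image.  Fix a disc; having a value in that disc at some
    point of [U] is an open condition on [lam], because a value of the series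
    depends, up to a small error, on finitely many digits.  It is also a dense
    condition: a finite prefix being prescribed, the remaining digits can be
    chosen so that the value at a suitable point of [U] is as close as wanted
    to any given complex number ([expansion_near]).  With two digits
    [m + h] and [m - h] this amounts to expanding a number in base [z] with
    digits [1] and [-1], for [z] near [zeta].  As [zeta] is not real, [1] and
    [zeta] span the plane over the reals, so two consecutive signs can always
    be chosen to move a large vector [y] towards [0] by an amount bounded below:
    for large [r], if [|y| <= r] then some [y - s - s' zeta] has squared norm at
    most [r ^ 2 - 4] ([sign_step]).  When [z] is close enough to [zeta] this gain
    beats the factor [|z| ^ 2], hence the remainder [(y - s - s' z) / z ^ 2]
    still lies in the disc of radius [r] ([sign_step_near]) and the process can
    be iterated for ever ([greedy_expansion]).

    Openness of the image.  By the open mapping theorem it is enough that the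
    series is not constant near any point of the disc.  Taking distinct values
    at two given distinct points is an open dense condition, and when it holds
    for all pairs of complex rationals in the disc the series is nowhere locally
    constant ([separates_nonconstant]).

    The open mapping theorem ([pser_open_at]) is proved for power series with
    bounded coefficients only.  That class is stable under
    [f |-> (f z - f w) / (z - w)] ([pser_quot]); iterating this quotient gives
    the local form [f z = f w + (z - w) ^ k * g z] with [g w <> 0]
    ([local_expansion]), from which a [k]-th root shows that [|f - v|] has no
    nonzero local minimum ([modulus_decrease]).  A minimum of [|f - v|] on a
    small closed disc is therefore a zero as soon as it is interior. *)

(** * The real-valued modulus and the topology of the complex plane *)

Section Modulus.
Variable R : realType.
Local Notation C := (Cplx R).
Implicit Types (z w : C) (x y e : R).

(** The norm of [Cplx R] takes its values in [R[i]], which is only partially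
    ordered; [cabs] is its real-valued version, so that estimates live in an
    ordered field.  The other operations are retyped from [R[i]] to [Cplx R],
    the type that carries the topology. *)
Definition ofR x : C := (x%:C)%C.
Definition cabs z : R := complex.Re `|z|.
Definition reC z : R := complex.Re z.
Definition imC z : R := complex.Im z.
Definition mkC x y : C := (x +i* y)%C.

Lemma norm_cabs z : `|z| = ofR (cabs z).
Proof. by rewrite /ofR /cabs normc_def. Qed.

Lemma cabsE z : cabs z = Num.sqrt (reC z ^+ 2 + imC z ^+ 2).
Proof. by rewrite /cabs normc_def. Qed.

Lemma cabs_ge0 z : 0 <= cabs z.
Proof. by rewrite cabsE sqrtr_ge0. Qed.

Lemma cabs_sqr z : cabs z ^+ 2 = reC z ^+ 2 + imC z ^+ 2.
Proof. by rewrite cabsE sqr_sqrtr // addr_ge0 // sqr_ge0. Qed.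

Lemma ofR_inj : injective ofR.
Proof. exact: complexI. Qed.

Lemma ofR_le x y : (ofR x <= ofR y) = (x <= y).
Proof. exact: lecR. Qed.

Lemma ofR_lt x y : (ofR x < ofR y) = (x < y).
Proof. exact: ltcR. Qed.

Lemma ofR0 : ofR 0 = 0. Proof. by []. Qed.
Lemma ofR1 : ofR 1 = 1. Proof. by []. Qed.
Lemma ofRD x y : ofR (x + y) = ofR x + ofR y.
Proof. exact: (rmorphD (real_complex R)). Qed.
Lemma ofRM x y : ofR (x * y) = ofR x * ofR y.
Proof. exact: (rmorphM (real_complex R)). Qed.
Lemma ofRX x n : ofR (x ^+ n) = ofR x ^+ n.
Proof. exact: (rmorphXn (real_complex R)). Qed.
Lemma ofRB x y : ofR (x - y) = ofR x - ofR y.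
Proof. exact: (rmorphB (real_complex R)). Qed.

Lemma cabsM z w : cabs (z * w) = cabs z * cabs w.
Proof. by apply: ofR_inj; rewrite ofRM -!norm_cabs normrM. Qed.

Lemma cabsX z n : cabs (z ^+ n) = cabs z ^+ n.
Proof. by apply: ofR_inj; rewrite ofRX -!norm_cabs normrX. Qed.

Lemma cabsD z w : cabs (z + w) <= cabs z + cabs w.
Proof. by rewrite -ofR_le ofRD -!norm_cabs ler_normD. Qed.

Lemma cabsN z : cabs (- z) = cabs z.
Proof. by apply: ofR_inj; rewrite -!norm_cabs normrN. Qed.

Lemma cabsC z w : cabs (z - w) = cabs (w - z).
Proof. by rewrite -cabsN opprB. Qed.

Lemma cabsB z w : cabs (z - w) <= cabs z + cabs w.
Proof. by rewrite -(cabsN w) cabsD. Qed.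

Lemma cabs_triangle u z w : cabs (z - w) <= cabs (z - u) + cabs (u - w).
Proof. by rewrite -[z - w](subrKA u) cabsD. Qed.

Lemma cabs0 : cabs 0 = 0.
Proof. by apply: ofR_inj; rewrite -norm_cabs normr0. Qed.

Lemma cabs1 : cabs 1 = 1.
Proof. by apply: ofR_inj; rewrite -norm_cabs normr1. Qed.

Lemma cabs_eq0 z : (cabs z == 0) = (z == 0).
Proof. by rewrite -(inj_eq ofR_inj) -norm_cabs normr_eq0. Qed.

Lemma cabs_gt0 z : (0 < cabs z) = (z != 0).
Proof. by rewrite lt0r cabs_ge0 andbT cabs_eq0. Qed.

Lemma cabs_ofR x : cabs (ofR x) = `|x|.
Proof. by rewrite cabsE /reC /imC /= expr0n addr0 sqrtr_sqr. Qed.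

Lemma cabs_sub_ge z w : cabs z - cabs w <= cabs (z - w).
Proof. by rewrite lerBlDr (le_trans _ (cabsD _ _)) // subrK. Qed.

Lemma cabs_dist_lip z w u : `|cabs (z - u) - cabs (w - u)| <= cabs (z - w).
Proof.
rewrite ler_norml lerBlDr cabs_triangle andbT lerNl opprB lerBlDr (cabsC z w).
exact: cabs_triangle.
Qed.

Lemma cabsV z : cabs z^-1 = (cabs z)^-1.
Proof.
have [->|z0] := eqVneq z 0; first by rewrite invr0 cabs0 invr0.
have cz : cabs z != 0 by rewrite cabs_eq0.
by apply: (mulfI cz); rewrite -cabsM !divff // cabs1.
Qed.

Lemma reC_le z : `|reC z| <= cabs z.
Proof.
by rewrite cabsE -sqrtr_sqr ler_wsqrtr // lerDl sqr_ge0.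
Qed.

Lemma imC_le z : `|imC z| <= cabs z.
Proof.
by rewrite cabsE -sqrtr_sqr ler_wsqrtr // lerDr sqr_ge0.
Qed.

Lemma mkC_le x y : cabs (mkC x y) <= `|x| + `|y|.
Proof.
rewrite cabsE /mkC /reC /imC /= -[leRHS]ger0_norm ?addr_ge0 //.
rewrite -sqrtr_sqr ler_wsqrtr // sqrrD !real_normK ?num_real //.
by rewrite lerD2r lerDl mulrn_wge0 // mulr_ge0.
Qed.

Lemma mkCE z : z = mkC (reC z) (imC z).
Proof. by case: z. Qed.

Lemma reCB z w : reC (z - w) = reC z - reC w.
Proof. by case: z => a b; case: w. Qed.
Lemma imCB z w : imC (z - w) = imC z - imC w.
Proof. by case: z => a b; case: w. Qed.

Lemma cvgC_cabsP (T : Type) (F : set_system T) {FF : Filter F} (f : T -> C) (l : C) :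
  f @ F --> l <-> forall e, 0 < e -> \forall t \near F, cabs (l - f t) < e.
Proof.
rewrite cvgrPdist_lt; split=> H e e0.
  have : 0 < ofR e by rewrite -ofR0 ofR_lt.
  by move=> /H; apply: filterS => t; rewrite norm_cabs ofR_lt.
have ee : e = ofR (complex.Re e) by rewrite /ofR RRe_real // gtr0_real.
rewrite ee; have : 0 < complex.Re e by rewrite -ofR_lt -ee.
by move=> /H; apply: filterS => t; rewrite norm_cabs ofR_lt.
Qed.

Lemma nbhsC_cabsP (A : set C) (z : C) :
  nbhs z A <-> exists2 e, 0 < e & forall w, cabs (w - z) < e -> A w.
Proof.
split=> [/nbhs_ballP[e /= e0 eA]|[e e0 eA]].
  have ee : e = ofR (complex.Re e) by rewrite /ofR RRe_real // gtr0_real.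
  exists (complex.Re e); first by rewrite -ofR_lt -ee.
  by move=> w we; apply: eA; rewrite -ball_normE /= distrC norm_cabs ee ofR_lt.
apply/nbhs_ballP; exists (ofR e); first by rewrite /= -ofR0 ofR_lt.
by move=> w; rewrite -ball_normE /= distrC norm_cabs ofR_lt => /eA.
Qed.

Lemma openC_cabsP (A : set C) : open A <->
  forall z, A z -> exists2 e, 0 < e & forall w, cabs (w - z) < e -> A w.
Proof.
rewrite openE; split => H z /H /=; rewrite /interior.
  by move/nbhsC_cabsP.
by move=> ?; apply/nbhsC_cabsP.
Qed.

Lemma mkC_continuous : continuous (fun p : R * R => mkC p.1 p.2).
Proof.
move=> [x y]; apply/cvgC_cabsP => e e0.
have e2 : 0 < e / 2 by rewrite divr_gt0.
exists (ball x (e / 2), ball y (e / 2)); first by split; exact: nbhsx_ballx.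
move=> [a b] /= [ha hb].
have -> : mkC x y - mkC a b = mkC (x - a) (y - b) by [].
apply: le_lt_trans (mkC_le _ _) _.
by move: ha hb; rewrite -!ball_normE /=; lra.
Qed.

Definition ratC (p : rat * rat) : C := mkC (ratr p.1) (ratr p.2).

Lemma rat_near z e : 0 < e -> exists p : rat * rat, cabs (ratC p - z) < e.
Proof.
move=> e0; have e2 : 0 < e / 2 by rewrite divr_gt0.
have [p] : exists q : rat, ratr q \in `]reC z - e / 2, reC z + e / 2[.
  by apply: rat_in_itvoo; lra.
have [q] : exists q : rat, ratr q \in `]imC z - e / 2, imC z + e / 2[.
  by apply: rat_in_itvoo; lra.
rewrite !in_itv /= => qz pz; exists (p, q); rewrite /ratC /=.
rewrite [X in _ - X]mkCE.
have -> (a b c d : R) : mkC a b - mkC c d = mkC (a - c) (b - d) by [].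
apply: le_lt_trans (mkC_le _ _) _; rewrite [ltRHS]splitr ltrD // ltr_norml; lra.
Qed.

(** The disc is closed in a square, which is the image of a product of two
    compact segments. *)
Lemma compact_cdisc (c : C) r : compact [set z | cabs (z - c) <= r].
Proof.
pose Q := (fun p : R * R => mkC p.1 p.2) @`
  (`[reC c - r, reC c + r] `*` `[imC c - r, imC c + r]).
have cQ : compact Q.
  apply: continuous_compact.
    by apply: continuous_subspaceT => p; exact: mkC_continuous.
  by apply: compact_setX; exact: segment_compact.
apply: subclosed_compact cQ _; last first.
  move=> z /= zr; exists (reC z, imC z); last by rewrite /= -mkCE.
  have := le_trans (reC_le _) zr; have := le_trans (imC_le _) zr.
  rewrite reCB imCB !ler_norml => /andP[h1 h2] /andP[h3 h4].
  by split; rewrite /= in_itv /=; lra.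
rewrite -[X in closed X]setCK closedC; apply/openC_cabsP => z /= /negP.
rewrite -ltNge => rz; exists (cabs (z - c) - r); first by rewrite subr_gt0.
move=> w wz; apply/negP; rewrite -ltNge.
have := cabs_triangle w z c; rewrite (cabsC z w); lra.
Qed.

Lemma unit_disk_cabs z : unit_disk R z -> cabs z < 1.
Proof. by rewrite /unit_disk /= norm_cabs -ofR1 ofR_lt. Qed.

End Modulus.

(** * Power series with bounded coefficients *)

Section BoundedPowerSeries.
Variable R : realType.
Local Notation C := (Cplx R).
Implicit Types (z w : C) (M e : R) (a b : nat -> C).

Definition pser a z : C := limn (series (fun n => a n * z ^+ n)).

Definition digits (L : set C) (lam : Omega L) : nat -> C :=
  fun n => set_val (lam n).

Lemma fserE (L : set C) (lam : Omega L) z : fser lam z = pser (digits lam) z.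
Proof. by []. Qed.

Definition coef_le M a := forall n, cabs (a n) <= M.

Definition coef_shift a : nat -> C := fun n => a n.+1.

Lemma coef_le_ge0 M a : coef_le M a -> 0 <= M.
Proof. by move=> /(_ 0%N); apply: le_trans; exact: cabs_ge0. Qed.

Lemma coef_shift_le M a : coef_le M a -> coef_le M (coef_shift a).
Proof. by move=> aM n; exact: aM. Qed.

(** Real and imaginary parts are dominated by a geometric series, so each of
    them converges by completeness of the real line. *)
Lemma is_cvg_pser M a z : coef_le M a -> cabs z < 1 ->
  cvgn (series (fun n => a n * z ^+ n)).
Proof.
move=> aM z1; set u := fun n => _.
have dom (f : C -> R) : (forall c, `|f c| <= cabs c) -> cvgn (series (f \o u)).
  move=> fle; apply: (@normed_cvg _ R^o).
  apply: (@series_le_cvg _ _ (geometric M (cabs z))) => [n|n|n|].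
  - exact: normr_ge0.
  - by rewrite /= mulr_ge0 ?exprn_ge0 ?cabs_ge0 // (coef_le_ge0 aM).
  - by rewrite (le_trans (fle _)) // cabsM cabsX ler_wpM2r ?exprn_ge0 ?cabs_ge0.
  - by apply: is_cvg_geometric_series; rewrite ger0_norm // cabs_ge0.
have /cvg_ex[x ux] := dom _ (@reC_le R); have /cvg_ex[y uy] := dom _ (@imC_le R).
apply/cvg_ex; exists (mkC x y); apply/cvgC_cabsP => e e0.
have e2 : 0 < e / 2 by rewrite divr_gt0.
have reS n : reC (series u n) = series (@reC R \o u) n.
  rewrite /series /= (big_morph (@reC R) (id1 := 0) (op1 := +%R)) //.
  by move=> [? ?] [? ?].
have imS n : imC (series u n) = series (@imC R \o u) n.
  rewrite /series /= (big_morph (@imC R) (id1 := 0) (op1 := +%R)) //.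
  by move=> [? ?] [? ?].
move/cvgrPdist_lt : ux => /(_ _ e2) ux; move/cvgrPdist_lt : uy => /(_ _ e2) uy.
near=> n; rewrite (mkCE (series u n)) reS imS.
have -> (p q r s : R) : mkC p q - mkC r s = mkC (p - r) (q - s) by [].
apply: le_lt_trans (mkC_le _ _) _; rewrite [ltRHS]splitr ltrD //.
  by near: n.
by near: n.
Unshelve. all: by end_near. Qed.

Lemma pser_near M a z e : coef_le M a -> cabs z < 1 -> 0 < e ->
  \forall n \near \oo, cabs (pser a z - series (fun n => a n * z ^+ n) n) < e.
Proof.
move=> aM z1 e0; move: e e0; apply/cvgC_cabsP; exact: (is_cvg_pser aM z1).
Qed.

(** With the bound [pser_le], this recursion is all that the later arguments use
    about infinite sums: the identities below hold up to [z ^ n] times a bounded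
    error term for every [n]. *)
Lemma pser_rec M a z : coef_le M a -> cabs z < 1 ->
  pser a z = a 0%N + z * pser (coef_shift a) z.
Proof.
move=> aM z1; have cs := is_cvg_pser (coef_shift_le aM) z1.
(* The partial sums satisfy the recursion with a shift of one in the rank. *)
have L : series (fun n => a n * z ^+ n) @ \oo --> a 0%N + z * pser (coef_shift a) z.
  rewrite -(cvg_shiftn 1).
  have -> : (fun n => series (fun n => a n * z ^+ n) (n + 1)%N) =
     (fun n => a 0%N + z * series (fun n => coef_shift a n * z ^+ n) n).
    apply/funext => n; rewrite addn1 /series /= big_nat_recl // expr0 mulr1.
    congr (_ + _); rewrite mulr_sumr; apply: eq_bigr => i _.
    by rewrite exprS mulrCA.
  by apply: cvgD; [exact: cvg_cst|apply: cvgM; [exact: cvg_cst|exact: cs]].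
exact: (cvg_lim (@norm_hausdorff _ _) L).
Qed.

Lemma pser_le M a z : coef_le M a -> cabs z < 1 ->
  cabs (pser a z) <= M / (1 - cabs z).
Proof.
move=> aM z1; apply/ler_addgt0Pr => e e0.
have [n _ /(_ n (leqnn _))/= H] := pser_near aM z1 e0.
have zp : 0 < 1 - cabs z by rewrite subr_gt0.
suff : cabs (series (fun n => a n * z ^+ n) n) <= M / (1 - cabs z).
  by have := cabs_sub_ge (pser a z) (series (fun n => a n * z ^+ n) n); lra.
elim: n a aM {H} => [|n IH] a aM.
  by rewrite /series /= big_geq // cabs0 divr_ge0 ?(ltW zp) // (coef_le_ge0 aM).
have := IH _ (coef_shift_le aM).
rewrite /series /= big_nat_recl // expr0 mulr1.
have -> : \sum_(0 <= i < n) a i.+1 * z ^+ i.+1 =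
    z * \sum_(0 <= i < n) coef_shift a i * z ^+ i.
  by rewrite mulr_sumr; apply: eq_bigr => i _; rewrite exprS mulrCA.
move: (\sum_(_ <= _ < _) _) => s sM.
rewrite (le_trans (cabsD _ _)) // cabsM.
have -> : M / (1 - cabs z) = M + cabs z * (M / (1 - cabs z)).
  by field; rewrite gt_eqF.
by rewrite lerD // ler_wpM2l ?cabs_ge0.
Qed.

(** For [f z = \sum a_n z ^ n], the quotient [(f z - f w) / (z - w)] is a power
    series whose [n]-th coefficient is [\sum_(m > n) a_m w ^ (m - n - 1)]. *)
Definition quot_coef w a : nat -> C := fun n => pser (iter n.+1 coef_shift a) w.

Lemma iter_coef_shift_le M a n : coef_le M a -> coef_le M (iter n coef_shift a).
Proof. by move=> aM; elim: n => //= n; exact: coef_shift_le. Qed.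

Lemma quot_coef_le M a w : coef_le M a -> cabs w < 1 ->
  coef_le (M / (1 - cabs w)) (quot_coef w a).
Proof. by move=> aM w1 n; apply: pser_le => //; exact: iter_coef_shift_le. Qed.

Lemma geom_lt x K e : 0 <= x < 1 -> 0 < e -> exists n, K * x ^+ n < e :> R.
Proof.
move=> /andP[x0 x1] e0.
have : geometric K x @ \oo --> 0 by apply: cvg_geometric; rewrite ger0_norm.
move=> /cvgrPdist_lt/(_ _ e0)[n _ /(_ n (leqnn _)) /=].
by rewrite sub0r normrN => H; exists n; apply: le_lt_trans H; exact: ler_norm.
Qed.

Lemma quot_identity (A : comPzRingType) (x z w p q r : A) :
  x + z * p - (x + w * q) - (z - w) * (q + z * r) =
  z * (p - q - (z - w) * r).
Proof. by ring. Qed.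

(** The defect [E a] of the identity satisfies [E a = z * E (coef_shift a)] and
    is bounded uniformly over all sequences with coefficients bounded by [M];
    iterating the recursion forces it to be [0]. *)
Lemma pser_quot M a z w : coef_le M a -> cabs z < 1 -> cabs w < 1 ->
  pser a z - pser a w = (z - w) * pser (quot_coef w a) z.
Proof.
move=> aM z1 w1.
pose E a := pser a z - pser a w - (z - w) * pser (quot_coef w a) z.
have Erec b : coef_le M b -> E b = z * E (coef_shift b).
  move=> bM; rewrite /E (pser_rec bM z1) (pser_rec bM w1).
  rewrite (pser_rec (quot_coef_le bM w1) z1).
  have -> : coef_shift (quot_coef w b) = quot_coef w (coef_shift b).
    by apply/funext => n; rewrite /coef_shift /quot_coef -iterSr.
  rewrite /quot_coef /=; exact: quot_identity.
pose K := M / (1 - cabs z) + M / (1 - cabs w) +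
  cabs (z - w) * (M / (1 - cabs w) / (1 - cabs z)).
have EK b : coef_le M b -> cabs (E b) <= K.
  move=> bM; rewrite /K; apply: (le_trans (cabsB _ _)); apply: lerD.
    by apply: (le_trans (cabsB _ _)); apply: lerD; exact: pser_le.
  by rewrite cabsM ler_wpM2l ?cabs_ge0 // pser_le //; exact: quot_coef_le.
have En n b : coef_le M b -> cabs (E b) <= K * cabs z ^+ n.
  elim: n b => [|n IH] b bM; first by rewrite expr0 mulr1 EK.
  rewrite Erec // cabsM exprS mulrCA ler_wpM2l ?cabs_ge0 // IH //.
  exact: coef_shift_le.
apply/eqP; rewrite -subr_eq0 -cabs_eq0 eq_le cabs_ge0 andbT.
apply/ler_addgt0Pr => e e0; rewrite add0r.
have [|n Kn] := @geom_lt (cabs z) K e _ e0; first by rewrite cabs_ge0.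
exact: le_trans (En n a aM) (ltW Kn).
Qed.

(** The value depends continuously on the coefficients for the product
    topology: the first [N] of them contribute at most [e / (1 - |z|)] to the
    difference, and the tails at most [2 M |z| ^ N / (1 - |z|)]. *)
Lemma pser_dist M a b z N e : coef_le M a -> coef_le M b -> cabs z < 1 ->
  (forall n, (n < N)%N -> cabs (a n - b n) <= e) -> 0 <= e ->
  cabs (pser a z - pser b z) <= (e + 2 * M * cabs z ^+ N) / (1 - cabs z).
Proof.
move=> + + z1 + e0; have zp : 0 < 1 - cabs z by rewrite subr_gt0.
elim: N a b => [|N IH] a b aM bM ab.
  have := cabsB (pser a z) (pser b z); have := pser_le aM z1; have := pser_le bM z1.
  have : 0 <= e / (1 - cabs z) by rewrite divr_ge0 // ltW.
  by rewrite expr0 mulr1 !mulrDl -mulrA; lra.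
have abS n : (n < N)%N -> cabs (coef_shift a n - coef_shift b n) <= e.
  by move=> nN; exact: (ab n.+1).
have {}IH := IH _ _ (coef_shift_le aM) (coef_shift_le bM) abS.
rewrite (pser_rec aM z1) (pser_rec bM z1) opprD addrACA -mulrBr.
apply: le_trans (cabsD _ _) _; rewrite cabsM exprS.
have -> : (e + 2 * M * (cabs z * cabs z ^+ N)) / (1 - cabs z) =
  e + cabs z * ((e + 2 * M * cabs z ^+ N) / (1 - cabs z)).
  by field; rewrite gt_eqF.
by rewrite lerD ?ab // ler_wpM2l ?cabs_ge0.
Qed.

Lemma pser_single M a b n z : coef_le M a -> coef_le M b -> cabs z < 1 ->
  (forall k, k != n -> a k = b k) ->
  pser a z - pser b z = (a n - b n) * z ^+ n.
Proof.
move=> + + z1; elim: n a b => [|n IH] a b aM bM ab.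
  rewrite (pser_rec aM z1) (pser_rec bM z1).
  have -> : coef_shift a = coef_shift b by apply/funext => k; exact: ab.
  by rewrite expr0 mulr1 opprD addrACA subrr addr0.
have abS k : k != n -> coef_shift a k = coef_shift b k by move=> kn; exact: ab.
have {}IH := IH _ _ (coef_shift_le aM) (coef_shift_le bM) abS.
rewrite (pser_rec aM z1) (pser_rec bM z1) opprD addrACA -mulrBr IH (ab 0%N) //.
by rewrite subrr add0r exprS mulrCA.
Qed.

Lemma pser_continuous_at M a w e : coef_le M a -> cabs w < 1 -> 0 < e ->
  exists2 d, 0 < d & forall z, cabs (z - w) < d ->
    cabs z < 1 /\ cabs (pser a z - pser a w) < e.
Proof.
move=> aM w1 e0; have M0 := coef_le_ge0 aM.
(* By [pser_quot] the function is Lipschitz with constant [K] on the disc of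
   radius [r] around [w], which stays away from the unit circle. *)
set r := (1 - cabs w) / 2; have r0 : 0 < r by rewrite divr_gt0 // subr_gt0.
set K := M / (1 - cabs w) / r.
have K0 : 0 <= K by rewrite /K !divr_ge0 // ltW // subr_gt0.
exists (Num.min r (e / (K + 1))).
  by rewrite lt_min r0 divr_gt0 // ltr_wpDl.
move=> z; rewrite lt_min => /andP[zr ze] /=.
have zw : cabs z <= cabs w + cabs (z - w).
  by have := cabs_sub_ge z w; lra.
have rE : r + r = 1 - cabs w by rewrite /r; field.
have z1 : cabs z < 1 by lra.
split=> //; rewrite (pser_quot aM z1 w1) cabsM.
have : cabs (pser (quot_coef w a) z) <= K.
  apply: (le_trans (pser_le (quot_coef_le aM w1) z1)).
  by rewrite /K ler_wpM2l ?divr_ge0 ?lef_pV2 ?posrE //; lra.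
move: ze; rewrite ltr_pdivlMr ?ltr_wpDl // => ze qK.
apply: le_lt_trans ze; rewrite ler_wpM2l ?cabs_ge0 //; lra.
Qed.

End BoundedPowerSeries.

#[local] Opaque pser fser.

(** * The open mapping theorem *)

Section OpenMapping.
Variable R : realType.
Local Notation C := (Cplx R).
Implicit Types (v w z : C) (M d e r : R) (a b : nat -> C).

Definition nonconstant_near a w :=
  forall d, 0 < d ->
    exists z, [/\ cabs (z - w) < d, cabs z < 1 & pser a z != pser a w].

Lemma iter_quot_coef_le M a w k : coef_le M a -> cabs w < 1 ->
  coef_le (M / (1 - cabs w) ^+ k) (iter k (quot_coef w) a).
Proof.
move=> aM w1; elim: k => [|k IH]; first by rewrite expr0 divr1.
by rewrite iterS exprSr invfM mulrA; exact: quot_coef_le.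
Qed.

Lemma pser_expansion M a w z k : coef_le M a -> cabs w < 1 -> cabs z < 1 ->
  (forall j, (j < k)%N -> pser (iter j.+1 (quot_coef w) a) w = 0) ->
  pser a z = pser a w + (z - w) ^+ k.+1 * pser (iter k.+1 (quot_coef w) a) z.
Proof.
move=> aM w1 z1; elim: k => [_|k IH Z].
  by rewrite expr1 -(pser_quot aM z1 w1) addrC subrK.
rewrite IH => [|j jk]; last by rewrite Z // ltnS ltnW.
rewrite [in RHS]exprSr -[in RHS]mulrA; congr (_ + _ * _).
by rewrite -(pser_quot (iter_quot_coef_le k.+1 aM w1) z1 w1) Z // subr0.
Qed.

(** If all iterated quotients vanished at [w], then [f z - f w] would be
    [(z - w) ^ n] times a function bounded by a constant times
    [(1 - |w|) ^- n]; it would thus be [0] on the disc of radius [1 - |w|]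
    around [w].  Otherwise the first nonzero one gives the expansion. *)
Lemma local_expansion M a w : coef_le M a -> cabs w < 1 ->
  nonconstant_near a w ->
  exists k M' b, [/\ coef_le M' b, pser b w != 0 &
    forall z, cabs z < 1 -> pser a z = pser a w + (z - w) ^+ k.+1 * pser b z].
Proof.
move=> aM w1 nc; have w0 : 0 < 1 - cabs w by rewrite subr_gt0.
have [H|Z] := pselect (exists k, pser (iter k.+1 (quot_coef w) a) w != 0).
  case: (ex_minnP H) => k qk kmin.
  exists k, (M / (1 - cabs w) ^+ k.+1), (iter k.+1 (quot_coef w) a).
  split=> //; first exact: iter_quot_coef_le.
  move=> z z1; apply: pser_expansion aM w1 z1 _ => j jk; apply/eqP.
  by apply: contraTT jk => /kmin; rewrite -leqNgt.
have {}Z k : pser (iter k.+1 (quot_coef w) a) w = 0.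
  by apply/eqP; apply: contra_notT Z => qk; exists k.
have [z [zw z1 /negP[]]] := nc _ w0.
rewrite -subr_eq0 -cabs_eq0 eq_le cabs_ge0 andbT.
apply/ler_addgt0Pr => e e0; rewrite add0r.
have x01 : 0 <= cabs (z - w) / (1 - cabs w) < 1.
  by rewrite divr_ge0 ?cabs_ge0 ?ltW // ltr_pdivrMr // mul1r.
set x := _ / _ in x01; have x0 : 0 <= x by case/andP: x01.
have [n Hn] := @geom_lt R x (x * (M / (1 - cabs z))) e x01 e0.
apply: le_trans (ltW Hn).
rewrite (@pser_expansion M a w z n aM w1 z1 (fun j _ => Z j)) addrAC subrr add0r.
rewrite cabsM cabsX.
apply: (@le_trans _ _ (cabs (z - w) ^+ n.+1 *
    (M / (1 - cabs w) ^+ n.+1 / (1 - cabs z)))).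
  rewrite ler_wpM2l ?exprn_ge0 ?cabs_ge0 // pser_le //.
  exact: iter_quot_coef_le.
rewrite [leRHS]mulrAC -exprS /x expr_div_n le_eqVlt; apply/orP; left.
by rewrite (mulrC M) !mulrA.
Qed.

Lemma perturb_identity (A : comPzRingType) (g T V p : A) :
  g + T * V * p = (1 - T) * g + T * (V * p - - g).
Proof. by ring. Qed.

(** Write [f z - v = g + (z - w) ^ k * (q + o(1))] with [g, q <> 0], and move
    from [w] in the direction [u] such that [u ^ k * q = - g]: for small [t > 0]
    the modulus at [w + t u] is [|g| (1 - t ^ k + o(t ^ k))]. *)
Lemma modulus_decrease M a w v d : coef_le M a -> cabs w < 1 ->
  nonconstant_near a w -> pser a w != v -> 0 < d ->
  exists z, [/\ cabs (z - w) < d, cabs z < 1 &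
    cabs (pser a z - v) < cabs (pser a w - v)].
Proof.
move=> aM w1 nc av d0.
have [k [M' [b [bM' q0 ab]]]] := local_expansion aM w1 nc.
have [g gE] : exists g, g = pser a w - v by exists (pser a w - v).
have [q qE] : exists q, q = pser b w by exists (pser b w).
rewrite -qE in q0.
have g0 : g != 0 by rewrite gE subr_eq0.
have qp : 0 < cabs q by rewrite cabs_gt0.
have q2 : 0 < cabs q / 2 by rewrite divr_gt0.
have [d' d'0 bd'] := pser_continuous_at bM' w1 q2.
pose u : C := (k.+1).-root (- g / q).
have uk : u ^+ k.+1 * q = - g by rewrite /u rootCK // divfK.
have u0 : 0 <= cabs u by exact: cabs_ge0.
(* The step [t] keeps [w + t u] within distance [m] of [w], where the error on
   [q] is at most [|q| / 2]. *)
pose m := Num.min d d'; have m0 : 0 < m by rewrite lt_min d0 d'0.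
pose t := Num.min 1 (m / (cabs u + 1)).
have t0 : 0 < t by rewrite lt_min ltr01 divr_gt0 // ltr_wpDl.
have t1 : t <= 1 by rewrite ge_min lexx.
have tm : t * cabs u < m.
  have : t <= m / (cabs u + 1) by rewrite ge_min lexx orbT.
  by rewrite ler_pdivlMr ?ltr_wpDl // mulrDr mulr1; lra.
pose z : C := w + ofR t * u.
have zw : z - w = ofR t * u by rewrite /z addrC addKr.
have : cabs (z - w) < m by rewrite zw cabsM cabs_ofR gtr0_norm.
rewrite lt_min => /andP[zd /bd'[z1 bz]].
exists z; split=> //; rewrite -[pser a w - v]gE.
have T0 : 0 < t ^+ k.+1 by rewrite exprn_gt0.
have T1 : t ^+ k.+1 <= 1 by rewrite exprn_ile1 // ltW.
have -> : pser a z - v =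
    ofR (1 - t ^+ k.+1) * g + ofR (t ^+ k.+1) * (u ^+ k.+1 * (pser b z - q)).
  rewrite ab // zw exprMn mulrBr uk ofRB ofR1 ofRX addrAC -gE.
  by move: (_ ^+ _) (u ^+ _) (pser b z) => T V p; exact: perturb_identity.
have ug : cabs (u ^+ k.+1) * cabs q = cabs g by rewrite -cabsM uk cabsN.
have Ub : cabs (u ^+ k.+1 * (pser b z - q)) <= cabs g / 2.
  rewrite -qE in bz; rewrite cabsM -ug -mulrA.
  by rewrite ler_wpM2l ?cabs_ge0 // ltW.
have gp : 0 < cabs g by rewrite cabs_gt0.
apply: le_lt_trans (cabsD _ _) _.
rewrite !(cabsM (ofR _)) !cabs_ofR (gtr0_norm T0) ger0_norm ?subr_ge0 //.
have := ler_wpM2l (ltW T0) Ub; have := mulr_gt0 T0 gp; rewrite mulrBl mul1r; lra.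
Qed.

(** On a small circle around [w], [|f - f w|] is bounded below by some [m > 0].
    If [|v - f w| < m / 2], the minimum of [|f - v|] over the closed disc is less
    than [m / 2], its values on the circle are larger, so the minimum is
    interior; by [modulus_decrease] it is [0]. *)
Lemma pser_open_at M a w r : coef_le M a -> 0 < r ->
  (forall z, cabs (z - w) < r -> cabs z < 1) ->
  (forall z, cabs z < 1 -> nonconstant_near a z) ->
  exists2 e, 0 < e & forall v, cabs (v - pser a w) < e ->
    exists2 z, cabs (z - w) < r & pser a z = v.
Proof.
move=> aM r0 rD nc.
have w1 : cabs w < 1 by apply: rD; rewrite subrr cabs0.
have [k [M' [b [bM' q0 ab]]]] := local_expansion aM w1 (nc _ w1).
have [q qE] : exists q, q = pser b w by exists (pser b w).
rewrite -qE in q0; have qp : 0 < cabs q by rewrite cabs_gt0.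
have q2 : 0 < cabs q / 2 by rewrite divr_gt0.
have [d d0 bd] := pser_continuous_at bM' w1 q2.
pose s := Num.min r d / 2.
have m0 : 0 < Num.min r d by rewrite lt_min r0.
have s0 : 0 < s by rewrite divr_gt0.
have [sr sd] : s < r /\ s < d.
  have : Num.min r d <= d by rewrite ge_min lexx orbT.
  have : Num.min r d <= r by rewrite ge_min lexx.
  by rewrite /s; split; lra.
pose m := s ^+ k.+1 * (cabs q / 2).
have mp : 0 < m by rewrite mulr_gt0 ?exprn_gt0.
exists (m / 2) => [|v vm]; first by rewrite divr_gt0.
have circle z : cabs (z - w) = s -> m <= cabs (pser a z - pser a w).
  move=> zs; have [|z1 bz] := bd z; first by rewrite zs.
  rewrite (ab _ z1) [pser a w + _]addrC addrK cabsM cabsX zs.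
  rewrite ler_wpM2l ?exprn_ge0 ?(ltW s0) //; rewrite -qE in bz.
  by have := cabs_sub_ge q (q - pser b z); rewrite subKr (cabsC q); lra.
pose h z := cabs (pser a z - v).
pose A := [set z : C | cabs (z - w) <= s].
have AD z : A z -> cabs z < 1 by move=> zs; apply: rD; exact: le_lt_trans zs sr.
have hc : {within A, continuous h}.
  apply: continuous_in_subspaceT => z /set_mem /AD z1.
  apply/(@cvgrPdist_lt _ _ _ (nbhs z) _ h) => e e0.
  have [d1 d10 H] := pser_continuous_at aM z1 e0.
  apply/nbhsC_cabsP; exists d1 => // x /H[_ /=]; apply: le_lt_trans.
  by rewrite (cabsC (pser a x)); exact: cabs_dist_lip.
have A0 : A !=set0 by exists w; rewrite /A /= subrr cabs0 ltW.
have [z1 /set_mem Az1 hmin] := compact_EVT_min A0 (@compact_cdisc _ w s) hc.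
have {}hmin z : A z -> h z1 <= h z by move=> Az; apply: hmin; rewrite inE.
have z1s : cabs (z1 - w) < s.
  rewrite lt_neqAle Az1 andbT; apply/eqP => /circle zm.
  have : h z1 <= h w by apply: hmin; rewrite /A /= subrr cabs0 ltW.
  rewrite /h; move: zm vm; move: (pser a z1) (pser a w) => x y xy vy xv.
  have := cabs_triangle v x y; rewrite (cabsC y v) in xv; lra.
exists z1; first exact: lt_trans z1s sr.
apply/eqP/negPn/negP => hv.
have dz : 0 < s - cabs (z1 - w) by rewrite subr_gt0.
have [z [zz zD]] := modulus_decrease aM (AD _ Az1) (nc _ (AD _ Az1)) hv dz.
apply/negP; rewrite -leNgt; apply: hmin; rewrite /A /=.
by have := cabs_triangle z1 z w; lra.
Qed.

End OpenMapping.

(** * Greedy expansions in a non-real base *)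

Section Greedy.
Variable R : realType.
Local Notation C := (Cplx R).
Implicit Types (v w y z zeta : C) (M B d e r : R) (l : nat -> C).

Definition is_sign (x : R) := x = 1 \/ x = -1.

Lemma sign_norm (x : R) : exists2 s, is_sign s & s * x = `|x|.
Proof.
have [x0|x0] := leP 0 x.
  by exists 1; [left|rewrite mul1r ger0_norm].
by exists (-1); [right|rewrite mulN1r ltr0_norm].
Qed.

(** The signs are those of the scalar products of [y] with [1] and with [zeta].
    Their absolute values add up to at least [|y| |Im zeta| / 2], so subtracting
    [s1 + s2 * zeta] lowers [|y| ^ 2] by [|y| |Im zeta|] up to an additive [4].
    This convex function of [|y|] is largest at the ends of [[0, r]], where the
    hypothesis on [r] bounds it. *)
Lemma sign_step zeta y r : cabs zeta = 1 -> 8 <= r * `|imC zeta| -> cabs y <= r ->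
  exists s1 s2, [/\ is_sign s1, is_sign s2 &
    cabs (y - (ofR s1 + ofR s2 * zeta)) ^+ 2 <= r ^+ 2 - 4].
Proof.
move=> z1 rs yr.
have [s1 s1s s1x] := sign_norm (reC y).
have [s2 s2s s2x] := sign_norm (reC y * reC zeta + imC y * imC zeta).
exists s1, s2; split=> //.
have zz := cabs_sqr zeta; rewrite z1 expr1n in zz.
have yy := cabs_sqr y; have y0 := cabs_ge0 y.
rewrite cabs_sqr.
have -> : reC (y - (ofR s1 + ofR s2 * zeta)) = reC y - s1 - s2 * reC zeta.
  case: y zeta {z1 rs yr s1x s2x zz yy y0} => a b [c d].
  by rewrite /reC /=; ring.
have -> : imC (y - (ofR s1 + ofR s2 * zeta)) = imC y - s2 * imC zeta.
  case: y zeta {z1 rs yr s1x s2x zz yy y0} => a b [c d].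
  by rewrite /imC /=; ring.
have s1q : s1 ^+ 2 = 1 by case: s1s => ->; rewrite ?sqrrN expr1n.
have s2q : s2 ^+ 2 = 1 by case: s2s => ->; rewrite ?sqrrN expr1n.
have c1 : `|reC zeta| <= 1 by rewrite -z1 reC_le.
have d1 : `|imC zeta| <= 1 by rewrite -z1 imC_le.
have yab : cabs y <= `|reC y| + `|imC y| by rewrite {1}(mkCE y) mkC_le.
move: (reC y) (imC y) (reC zeta) (imC zeta) (cabs y)
  s1x s2x zz yy y0 yr rs c1 d1 yab => x t c s Y s1x s2x zz yy y0 yr rs c1 d1 yab.
have st : `|s| * `|t| <= `|x| + `|x * c + t * s|.
  rewrite -normrM; have -> : s * t = (x * c + t * s) - x * c by ring.
  apply: le_trans (ler_normB _ _) _; rewrite addrC lerD2r normrM.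
  by rewrite ler_piMr.
have sx : `|s| * `|x| <= `|x| by rewrite ler_piMl.
have SY : `|s| * Y <= `|s| * `|x| + `|s| * `|t| by rewrite -mulrDr ler_wpM2l.
have s12 : s1 * s2 * c <= 1.
  apply: le_trans (ler_norm _) _; rewrite !normrM.
  have -> : `|s1| = 1 by case: s1s => ->; rewrite ?normrN normr1.
  have -> : `|s2| = 1 by case: s2s => ->; rewrite ?normrN normr1.
  by rewrite !mul1r.
have -> : (x - s1 - s2 * c) ^+ 2 + (t - s2 * s) ^+ 2 =
    Y ^+ 2 - 2 * (s1 * x + s2 * (x * c + t * s)) +
    (s1 ^+ 2 + s2 ^+ 2 * (c ^+ 2 + s ^+ 2) + 2 * (s1 * s2 * c)).
  by rewrite yy; ring.
rewrite s1x s2x s1q s2q -zz.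
have x0 : 0 <= `|x| by [].
have q0 : 0 <= `|x * c + t * s| by [].
have S0 : 0 <= `|s| by [].
move: (`|x|) (`|x * c + t * s|) (`|t|) (`|s|) st sx SY yab rs d1 x0 q0 S0
  => X Q T S st sx SY yab rs d1 x0 q0 S0.
have r8 : 8 <= r by nra.
(* That is, [Y ^ 2 - S * Y <= r ^ 2 - S * r]. *)
have : (r - Y) * (Y + r - S) >= 0 by rewrite mulr_ge0; lra.
nra.
Qed.

Lemma move_identity (A : comPzRingType) (y s s' z w : A) :
  y - (s + s' * z) = y - (s + s' * w) + s' * (w - z).
Proof. by ring. Qed.

(** Since [sqrt (r ^ 2 - 4) <= r - 2 / r], the step at [zeta] leaves a margin of
    [2 / r], which absorbs both the error [|z - zeta|] made by replacing [zeta]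
    with [z] and the loss [r - r |z| ^ 2 <= 2 r |z - zeta|]. *)
Lemma sign_step_near zeta r : cabs zeta = 1 -> 8 <= r * `|imC zeta| ->
  exists2 d, 0 < d & forall z y, cabs (z - zeta) < d -> cabs y <= r ->
  exists s1 s2, [/\ is_sign s1, is_sign s2 &
    cabs (y - (ofR s1 + ofR s2 * z)) <= r * cabs z ^+ 2].
Proof.
move=> z1 rs.
have d1 : `|imC zeta| <= 1 by rewrite -z1 imC_le.
have S0 : 0 <= `|imC zeta| by [].
have r0 : 0 < r.
  rewrite ltNge; apply/negP => r0.
  by have := mulr_le0_ge0 r0 S0; lra.
have r8 : 8 <= r by apply: le_trans rs _; rewrite ler_piMr // ltW.
pose q := 2 / r; have rq : r * q = 2 by rewrite /q; field; rewrite gt_eqF.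
have q0 : 0 < q by rewrite divr_gt0.
exists (q / (1 + 2 * r)); first by rewrite divr_gt0 //; lra.
move=> z y; rewrite ltr_pdivlMr; last by lra.
move=> zd yr; have [s1 [s2 [s1s s2s H]]] := sign_step z1 rs yr.
exists s1, s2; split=> //.
have H1 : cabs (y - (ofR s1 + ofR s2 * z)) <=
    cabs (y - (ofR s1 + ofR s2 * zeta)) + cabs (z - zeta).
  have -> : y - (ofR s1 + ofR s2 * z) =
      y - (ofR s1 + ofR s2 * zeta) + ofR s2 * (zeta - z).
    exact: move_identity.
  apply: le_trans (cabsD _ _) _; rewrite lerD2l cabsM cabs_ofR (cabsC z).
  by case: s2s => ->; rewrite ?normrN normr1 mul1r.
have z0 := cabs_ge0 z; have zd0 := cabs_ge0 (z - zeta).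
have := cabs_sub_ge zeta z; rewrite z1 (cabsC zeta) => zz.
apply: le_trans H1 _.
have A0 := cabs_ge0 (y - (ofR s1 + ofR s2 * zeta)).
move: (cabs (y - _)) (cabs (z - _)) (cabs z) A0 H z0 zd zd0 zz
  => A D Z A0 H Z0 Dd D0 DZ.
have q2 : q <= 1 by nra.
have Aq : A <= r - q.
  rewrite leNgt; apply/negP => rA.
  have : (r - q) ^+ 2 < A ^+ 2 by rewrite ltrXn2r //; lra.
  have -> : (r - q) ^+ 2 = r ^+ 2 - 2 * (r * q) + q ^+ 2 by ring.
  by rewrite rq; have := sqr_ge0 q; lra.
have rD : 0 <= r * D by rewrite mulr_ge0 // ltW.
have D1 : D <= 1 by lra.
have Z2 : 1 - 2 * D <= Z ^+ 2 by nra.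
have := ler_wpM2l (ltW r0) Z2; lra.
Qed.

Definition scons (c : C) l : nat -> C := fun n => if n is n'.+1 then l n' else c.

Lemma pser_scons M c l z : cabs c <= M -> coef_le M l -> cabs z < 1 ->
  pser (scons c l) z = c + z * pser l z.
Proof.
move=> cM lM z1.
have slM : coef_le M (scons c l) by case.
by rewrite (pser_rec slM z1).
Qed.

Lemma greedy_identity (F : fieldType) (y m h z p x1 x2 : F) : h != 0 -> z != 0 ->
  p * (1 - z) = m ->
  (y - (m + x1 * h) - (m + x2 * h) * z) / z ^+ 2 - p =
  h * ((y - p) / h - (x1 + x2 * z)) / z ^+ 2.
Proof. by move=> h0 z0 <-; field; rewrite h0 z0. Qed.

Lemma unroll_identity (F : fieldType) (y z c1 c2 x : F) : z != 0 ->
  y - (c1 + z * (c2 + z * x)) = z ^+ 2 * ((y - c1 - c2 * z) / z ^+ 2 - x).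
Proof. by move=> z0; field. Qed.

(** The number [p = m / (1 - z)] is the value of the constant sequence [m], the
    centre of the values that are reachable with digits [m + h] and [m - h].
    Two digits are peeled off at each stage: the remainder of [y] minus [p] is
    [h] times the remainder of the sign expansion of [(y - p) / h], which stays
    in the disc of radius [r].  After [k] stages the error is that of an
    arbitrary expansion, scaled by [z ^ (2 k)]. *)
Lemma greedy_expansion (L : set C) M (m h z p : C) r :
  (forall x, L x -> cabs x <= M) -> h != 0 ->
  (forall s, is_sign s -> L (m + ofR s * h)) ->
  z != 0 -> cabs z < 1 -> p * (1 - z) = m ->
  (forall y, cabs y <= r -> exists s1 s2, [/\ is_sign s1, is_sign s2 &
    cabs (y - (ofR s1 + ofR s2 * z)) <= r * cabs z ^+ 2]) ->
  exists K, forall k y, cabs (y - p) <= cabs h * r ->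
    exists2 l, (forall n, L (l n)) &
      cabs (y - pser l z) <= K * (cabs z ^+ 2) ^+ k.
Proof.
move=> LM h0 Lmh z0 z1 pm step.
have hp : 0 < cabs h by rewrite cabs_gt0.
have zp : 0 < cabs z ^+ 2 by rewrite exprn_gt0 // cabs_gt0.
have lM l : (forall n, L (l n)) -> coef_le M l by move=> Ll n; exact: LM.
exists (cabs h * r + cabs p + M / (1 - cabs z)).
elim=> [|k IH] y yp.
  have Lc : forall n : nat, L (m + ofR 1 * h) by move=> _; apply: Lmh; left.
  exists (fun=> m + ofR 1 * h) => //; rewrite expr0 mulr1.
  apply: le_trans (cabsB _ _) _; apply: lerD; last first.
    by apply: pser_le => //; exact: lM.
  by rewrite -lerBlDr (le_trans (cabs_sub_ge _ _)).
have [|s1 [s2 [s1s s2s H]]] := step ((y - p) / h).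
  by rewrite cabsM cabsV ler_pdivrMr // mulrC.
set c1 := m + ofR s1 * h; set c2 := m + ofR s2 * h.
have [|l Ll lH] := IH ((y - c1 - c2 * z) / z ^+ 2).
  rewrite greedy_identity // !cabsM cabsV cabsX ler_pdivrMr //.
  by rewrite -mulrA ler_wpM2l ?cabs_ge0.
have L1 : L c1 by exact: Lmh.
have L2 : L c2 by exact: Lmh.
have Ll2 n : L (scons c2 l n) by case: n.
exists (scons c1 (scons c2 l)); first by case.
rewrite (pser_scons (LM _ L1) (lM _ Ll2) z1) (pser_scons (LM _ L2) (lM _ Ll) z1).
rewrite unroll_identity // cabsM cabsX [in leRHS]exprS [leRHS]mulrCA.
by rewrite ler_wpM2l // ltW.
Qed.

Lemma bounded_cabs (L : set C) :
  bounded_set L -> exists M, forall x, L x -> cabs x <= M.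
Proof.
move=> [K [Kr KH]]; exists (complex.Re (K + 1)) => x Lx.
have K1 : K + 1 \is Num.real by rewrite realD // real1.
have := KH (K + 1); rewrite ltrDl ltr01 => /(_ isT x Lx) /=.
by rewrite norm_cabs -[K + 1]RRe_real // ofR_le.
Qed.

Lemma midpoint_plus (F : numFieldType) (a b : F) : (a + b) / 2 + (a - b) / 2 = a.
Proof. by field. Qed.

Lemma midpoint_minus (F : numFieldType) (a b : F) : (a + b) / 2 - (a - b) / 2 = b.
Proof. by field. Qed.

(** Every number of modulus at most [B] is approximated by values at [z] of
    digit sequences with the prescribed prefix.  For the empty prefix, [a] and
    [b] are written [m + h] and [m - h]; [|1 - z|] is bounded below near [zeta],
    hence so large a radius [r] exists that [h] times the disc of radius [r]
    contains all [v - p].  A first digit [c] is handled by expanding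
    [(v - c) / z], of modulus at most [2 (B + M)] when [|z| >= 1 / 2]; this is
    why the bound [B] is quantified before the neighbourhood of [zeta]. *)
Lemma expansion_near (L : set C) M (a b zeta : C) N l0 B :
  (forall x, L x -> cabs x <= M) -> L a -> L b -> a != b ->
  cabs zeta = 1 -> imC zeta != 0 -> (forall n, L (l0 n)) ->
  exists2 d, 0 < d & forall z, cabs z < 1 -> cabs (z - zeta) < d ->
    forall v e, cabs v <= B -> 0 < e ->
    exists l, [/\ forall n, L (l n), forall n, (n < N)%N -> l n = l0 n &
      cabs (v - pser l z) < e].
Proof.
move=> LM La Lb ab zeta1 imz.
have lM l : (forall n, L (l n)) -> coef_le M l by move=> Ll n; exact: LM.
have S0 : 0 < `|imC zeta| by rewrite normr_gt0.
have zetaN1 : 1 - zeta != 0.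
  by rewrite subr_eq0; apply: contraNneq imz => <-.
elim: N l0 B => [|N IH] l0 B Ll0.
  pose m : C := (a + b) / 2; pose h : C := (a - b) / 2.
  have h0 : h != 0 by rewrite mulf_neq0 ?invr_eq0 ?pnatr_eq0 // subr_eq0.
  have hp : 0 < cabs h by rewrite cabs_gt0.
  have Lmh s : is_sign s -> L (m + ofR s * h).
    case=> ->; first by rewrite mul1r /m /h midpoint_plus.
    have -> : ofR (-1) = -1 :> C by rewrite -[-1 in LHS]sub0r ofRB ofR0 ofR1 sub0r.
    by rewrite mulN1r /m /h midpoint_minus.
  pose P := cabs m / (cabs (1 - zeta) / 2).
  have P0 : 0 <= P by rewrite !mulr_ge0 ?invr_ge0 ?mulr_ge0 ?cabs_ge0 ?invr_ge0.
  pose r := Num.max (8 / `|imC zeta|) ((B + P) / cabs h).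
  have r1 : 8 <= r * `|imC zeta| by rewrite -ler_pdivrMr // le_max lexx.
  have r2 : B + P <= cabs h * r by rewrite mulrC -ler_pdivrMr // le_max lexx orbT.
  have [d d0 dstep] := sign_step_near zeta1 r1.
  exists (Num.min d (Num.min (1 / 2) (cabs (1 - zeta) / 2))).
    by rewrite !lt_min d0 !divr_gt0 ?cabs_gt0.
  move=> z z1; rewrite !lt_min => /and3P[zd z2 z3] v e vB e0.
  have zh : 1 / 2 <= cabs z.
    by have := cabs_sub_ge zeta z; rewrite zeta1 (cabsC zeta); lra.
  have z0 : z != 0 by rewrite -cabs_gt0; lra.
  have z1c : cabs (1 - zeta) / 2 <= cabs (1 - z).
    by have := cabs_triangle z 1 zeta; lra.
  have c0 : 0 < cabs (1 - zeta) / 2 by rewrite divr_gt0 // cabs_gt0.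
  have z1n : 1 - z != 0 by rewrite -cabs_gt0 (lt_le_trans c0).
  pose p := m / (1 - z).
  have pm : p * (1 - z) = m by rewrite /p divfK.
  have pP : cabs p <= P.
    rewrite /p /P cabsM cabsV ler_wpM2l ?cabs_ge0 // lef_pV2 ?posrE //.
    exact: lt_le_trans c0 z1c.
  have [K HK] := greedy_expansion LM h0 Lmh z0 z1 pm (fun y => dstep z y zd).
  have [|k Hk] := @geom_lt R (cabs z ^+ 2) K e _ e0.
    by rewrite exprn_ge0 ?cabs_ge0 // exprn_ilt1 // cabs_ge0.
  have [|l Ll lH] := HK k v.
    by apply: le_trans r2; apply: le_trans (cabsB _ _) _; exact: lerD.
  by exists l; split=> //; exact: le_lt_trans lH Hk.
have [d d0 H] := IH (coef_shift l0) (2 * (B + M)) (fun n => Ll0 n.+1).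
exists (Num.min d (1 / 2)) => [|z z1]; first by rewrite lt_min d0 divr_gt0.
rewrite lt_min => /andP[zd z2] v e vB e0.
have zh : 1 / 2 <= cabs z.
  by have := cabs_sub_ge zeta z; rewrite zeta1 (cabsC zeta); lra.
have z0 : z != 0 by rewrite -cabs_gt0; lra.
have [|l [Ll lN lH]] := H z z1 zd ((v - l0 0%N) / z) e _ e0.
  rewrite cabsM cabsV ler_pdivrMr ?cabs_gt0 //.
  apply: le_trans (cabsB _ _) _.
  have := LM _ (Ll0 0%N); have := cabs_ge0 (l0 0%N); have := cabs_ge0 v; nra.
exists (scons (l0 0%N) l).
split=> [[|n]|[|n]//|]; [exact: Ll0|exact: Ll|exact: lN|].
rewrite (pser_scons (LM _ (Ll0 0%N)) (lM _ Ll) z1).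
have -> : v - (l0 0%N + z * pser l z) = z * ((v - l0 0%N) / z - pser l z).
  by rewrite mulrBr mulrCA divff // mulr1 opprD addrA.
rewrite cabsM; apply: le_lt_trans lH.
by rewrite ler_piMl ?cabs_ge0 // ltW.
Qed.

End Greedy.

(** * Generic digit sequences *)

Section Generic.

(** A meager set is an exact union of nowhere dense sets, so the complements of
    the [G i] are cut down to the complement of [A]. *)
Lemma residual_bigcap (T : topologicalType) (I : countType) (G : I -> set T)
    (A : set T) :
  (forall i, open (G i)) -> (forall i, dense (G i)) ->
  (forall x, (forall i, G i x) -> A x) -> residual A.
Proof.
move=> Go Gd GA.
pose F n := if unpickle n is Some i then ~` G i `&` ~` A else set0.
exists F => [n|]; rewrite /F.
  rewrite /nowhere_dense; case: (unpickle n) => [i|]; last by rewrite closure0 interior0.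
  rewrite -subset0 => x xF; have : (~` G i)° x.
    have /closure_id -> : closed (~` G i) by rewrite closedC.
    by move: x xF; apply: interiorS; apply: closureS => y [].
  move=> xG; have [|y [/interior_subset]] := Gd i (~` G i)° _ (@open_interior _ _).
    by exists x.
  by [].
apply/seteqP; split=> [x Ax|x [n _]]; last by case: (unpickle n) => [i []|].
have [/GA//|/existsNP[i Gix]] := pselect (forall i, G i x).
by exists (pickle i) => //; rewrite pickleK.
Qed.

(** Sequences of [G] that agree with [x] on longer and longer prefixes converge
    to [x] coordinatewise. *)
Lemma dense_prefix (T : topologicalType)
    (G : set (prod_topology (fun _ : nat => T))) :
  (forall (x : nat -> T) N,
    exists2 y : nat -> T, G y & forall n, (n < N)%N -> y n = x n) ->
  dense G.
Proof.
move=> H O [x Ox] Oo.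
have {}H N : exists y : nat -> T, G y /\ forall n, (n < N)%N -> y n = x n.
  by have [y] := H x N; exists y.
have [y yP] := choice H.
have cy : y @ \oo --> (x : prod_topology (fun _ : nat => T)).
  apply/cvg_sup => i A; rewrite nbhsE => -[V [[B Bo <-] Bx] BA].
  exists i.+1 => // N /= iN; apply: BA => /=.
  by rewrite /= (yP N).2.
have [N _ /(_ N (leqnn _)) yO] : (y @ \oo) O by apply: cy; apply: open_nbhs_nbhs.
by exists (y N); split=> //; exact: (yP N).1.
Qed.

(** Two consecutive positive powers determine a number: if they agree for [p]
    and [q] then [p ^ n * (p - q) = 0]. *)
Lemma pow_distinct (A : idomainType) (p q : A) N :
  p != q -> exists2 n, (N <= n)%N & p ^+ n != q ^+ n.
Proof.
move=> pq; have [e1|] := eqVneq (p ^+ N.+1) (q ^+ N.+1); last by exists N.+1.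
exists N.+2; first exact: leqW (leqnSn N).
rewrite [p ^+ _]exprS [q ^+ _]exprS e1.
apply: contra_neq pq => /eqP; rewrite -subr_eq0 -mulrBl mulf_eq0 => /orP[|].
  by rewrite subr_eq0 => /eqP.
move=> q0; have /eqP q00 : q == 0 by rewrite expf_eq0 in q0; case/andP: q0.
move: e1; rewrite q00 expr0n /= => /eqP; rewrite expf_eq0 => /andP[_ /eqP //].
Qed.

Variable R : realType.
Local Notation C := (Cplx R).
Variable L : set C.
Implicit Types (lam : Omega L) (z w : C).

Lemma digits_in lam n : L (digits lam n).
Proof. exact: set_valP. Qed.

Lemma digits_surj (l : nat -> C) : (forall n, L (l n)) ->
  exists lam, digits lam = l.
Proof. by move=> Ll; exists (fun n => SigSub (mem_set (Ll n)) : set_type L). Qed.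

Lemma digits_inj lam1 lam2 n : digits lam1 n = digits lam2 n -> lam1 n = lam2 n.
Proof. exact: val_inj. Qed.

Lemma near_digits lam N e : 0 < e ->
  \forall x \near lam, forall n, (n < N)%N -> cabs (digits x n - digits lam n) < e.
Proof.
move=> e0; elim: N => [|N IH];
  first by apply: (@filterE _ _ (nbhs_filter lam)) => x n.
have HN : \forall x \near lam, cabs (digits x N - digits lam N) < e.
  pose V := [set t : set_type L | cabs (set_val t - set_val (lam N)) < e].
  have nV : nbhs (lam N) V.
    apply: (@initial_continuous _ _ (set_val : set_type L -> C) (lam N)
      [set t : C | cabs (t - set_val (lam N)) < e]).
    by apply/nbhsC_cabsP; exists e.
  exact: (@proj_continuous nat (fun=> set_type L) N lam V nV).
apply: (@filterS2 _ _ (nbhs_filter lam) _ _ _ _ HN IH) => x xN xn n.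
by rewrite ltnS leq_eqVlt => /predU1P[->//|/xn].
Qed.

Variable M : R.
Hypothesis LM : forall x, L x -> cabs x <= M.

Lemma digits_le lam : coef_le M (digits lam).
Proof. by move=> n; apply: LM; exact: digits_in. Qed.

Lemma near_pser_digits lam z e : cabs z < 1 -> 0 < e ->
  \forall x \near lam, cabs (pser (digits x) z - pser (digits lam) z) < e.
Proof.
move=> z1 e0; have zp : 0 < 1 - cabs z by rewrite subr_gt0.
pose d := e * (1 - cabs z) / 2.
have d0 : 0 < d by rewrite divr_gt0 // mulr_gt0.
have [|N HN] := @geom_lt R (cabs z) (2 * M) d _ d0; first by rewrite cabs_ge0.
apply: (@filterS _ _ (nbhs_filter lam) _ _ _ (near_digits lam N d0)) => x xd.
apply: (@le_lt_trans _ _ ((d + 2 * M * cabs z ^+ N) / (1 - cabs z))).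
  apply: pser_dist z1 _ (ltW d0); [exact: digits_le|exact: digits_le|].
  by move=> n /xd /ltW.
rewrite ltr_pdivrMr //.
have : d + d = e * (1 - cabs z) by rewrite /d; field.
lra.
Qed.

Lemma open_hits (U : set C) c e : U `<=` unit_disk R ->
  open [set lam : Omega L | exists2 z, U z & cabs (fser lam z - c) < e].
Proof.
move=> UD; rewrite openE => lam /= [z Uz ze].
have z1 : cabs z < 1 by apply: unit_disk_cabs; exact: UD.
have ez : 0 < e - cabs (fser lam z - c) by rewrite subr_gt0.
apply: (@filterS _ _ (nbhs_filter lam) _ _ _ (near_pser_digits lam z1 ez)) => x /=.
rewrite -!fserE => xz; exists z => //.
have := cabs_triangle (fser lam z) (fser x z) c; lra.
Qed.

Lemma dense_hits (U : set C) a b zeta c e :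
  U `<=` unit_disk R -> L a -> L b -> a != b ->
  unit_circle R zeta -> imC zeta != 0 -> limit_point U zeta -> 0 < e ->
  dense [set lam : Omega L | exists2 z, U z & cabs (fser lam z - c) < e].
Proof.
move=> UD La Lb ab zc imz acc e0; apply: dense_prefix => lam N.
have zeta1 : cabs zeta = 1 by apply: ofR_inj; rewrite -norm_cabs.
have [d d0 H] := expansion_near N (cabs c) LM La Lb ab zeta1 imz (digits_in lam).
have [|z [_ Uz zd]] := acc [set z | cabs (z - zeta) < d].
  by apply/nbhsC_cabsP; exists d.
have z1 : cabs z < 1 by apply: unit_disk_cabs; exact: UD.
have [l [Ll lN lc]] := H z z1 zd c e (lexx _) e0.
have [y yl] := digits_surj Ll.
exists y; first by exists z => //; rewrite cabsC fserE yl.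
by move=> n nN; apply: digits_inj; rewrite yl lN.
Qed.

Lemma open_separates p q : cabs p < 1 -> cabs q < 1 ->
  open [set lam : Omega L | fser lam p != fser lam q].
Proof.
move=> p1 q1; rewrite openE => lam /=; rewrite -subr_eq0 -cabs_gt0 => e0.
have e2 : 0 < cabs (fser lam p - fser lam q) / 2 by rewrite divr_gt0.
apply: (@filterS2 _ _ (nbhs_filter lam) _ _ _ _ (near_pser_digits lam p1 e2)
  (near_pser_digits lam q1 e2)) => x /=.
rewrite !fserE => xp xq; apply/eqP; move: xp xq.
move: (pser _ p) (pser _ q) (pser (digits lam) p) (pser _ q) => u v u' v'.
rewrite (cabsC u) => uu vv uv; rewrite uv in uu.
have := cabs_triangle v u' v'; lra.
Qed.

(** If [p] and [q] are not separated, changing one digit far away, at a rank [n]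
    with [p ^ n <> q ^ n], changes the two values by different amounts. *)
Lemma dense_separates a b p q : L a -> L b -> a != b ->
  cabs p < 1 -> cabs q < 1 -> p != q ->
  dense [set lam : Omega L | fser lam p != fser lam q].
Proof.
move=> La Lb ab p1 q1 pq; apply: dense_prefix => lam N.
have [lpq|/eqP lpq] := pselect (fser lam p = fser lam q); last by exists lam.
have [n Nn npq] := pow_distinct N pq.
have [c Lc cn] : exists2 c, L c & c != digits lam n.
  have [<-|/eqP an] := pselect (a = digits lam n); last by exists a.
  exists b; first exact: Lb.
  by rewrite eq_sym; exact: ab.
pose l k := if k == n then c else digits lam k.
have Ll k : L (l k) by rewrite /l; case: ifP => _; [exact: Lc|exact: digits_in].
have [y yl] := digits_surj Ll; exists y; last first.
  move=> k kN; have kn : (k == n) = false by exact: ltn_eqF (leq_trans kN Nn).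
  by apply: digits_inj; rewrite yl /l kn.
have diff z : cabs z < 1 -> fser y z - fser lam z = (c - digits lam n) * z ^+ n.
  move=> z1; rewrite !fserE (pser_single (n := n) (digits_le y) (digits_le lam) z1).
    by rewrite yl /l eqxx.
  by move=> k kn; rewrite yl /l (negbTE kn).
apply: contra_neq npq => ypq; apply: (@mulfI _ (c - digits lam n)).
  by rewrite subr_eq0.
by rewrite -(diff p p1) -(diff q q1) ypq lpq.
Qed.

(** Any disc contains two distinct complex rationals [p] and [q]; one of the
    distinct values at [p] and [q] differs from the value at [w]. *)
Lemma separates_nonconstant lam w :
  (forall p q : rat * rat, cabs (ratC R p) < 1 -> cabs (ratC R q) < 1 ->
     ratC R p != ratC R q -> fser lam (ratC R p) != fser lam (ratC R q)) ->
  cabs w < 1 -> nonconstant_near (digits lam) w.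
Proof.
move=> sep w1 d0 d00.
pose d := Num.min d0 (1 - cabs w).
have dp : 0 < d by rewrite lt_min d00 subr_gt0.
have dd0 : d <= d0 by rewrite ge_min lexx.
have dw : d <= 1 - cabs w by rewrite ge_min lexx orbT.
have d4 : 0 < d / 4 by rewrite divr_gt0.
pose w' : C := w + ofR (d / 2).
have ww : cabs (w' - w) = d / 2.
  by rewrite /w' addrC addKr cabs_ofR gtr0_norm // divr_gt0.
(* The centres are [d / 2] apart, hence [p] and [q] are distinct. *)
have [p pw] := rat_near w d4; have [q qw] := rat_near w' d4.
have qw2 : cabs (ratC R q - w) < d.
  by have := cabs_triangle w' (ratC R q) w; lra.
have p1 : cabs (ratC R p) < 1 by have := cabs_sub_ge (ratC R p) w; lra.
have q1 : cabs (ratC R q) < 1 by have := cabs_sub_ge (ratC R q) w; lra.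
have pq : ratC R p != ratC R q.
  apply/eqP => pq; rewrite -pq in qw.
  by have := cabs_triangle (ratC R p) w' w; rewrite (cabsC w' (ratC R p)); lra.
have := sep p q p1 q1 pq; rewrite !fserE => spq.
have [e|/eqP ne] :=
  pselect (pser (digits lam) (ratC R p) = pser (digits lam) w); last first.
  by exists (ratC R p); split=> //; lra.
by exists (ratC R q); split; [lra|exact: q1|rewrite -e eq_sym].
Qed.

End Generic.

Theorem theorem1 (R : realType) (Lambda : set (Cplx R))
    (Lambda_bounded : bounded_set Lambda)
    (Lambda_two : exists a b : Cplx R, [/\ Lambda a, Lambda b & a != b])
    (Omega_Baire : Baire_space (Omega Lambda))
    (U : set (Cplx R)) (U_disk : U `<=` unit_disk R) (U_open : open U)
    (zeta : Cplx R) (zeta_circle : unit_circle R zeta)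
    (zeta_acc : limit_point U zeta) (zeta_Im : 'Im zeta != 0) :
  generic (fun lambda : Omega Lambda =>
    dense (fser lambda @` U) /\ open (fser lambda @` U)).
Proof.
have [M LM] := bounded_cabs Lambda_bounded.
have [a [b [La Lb ab]]] := Lambda_two.
have imz : imC zeta != 0.
  by apply: contra_neq zeta_Im => im0; rewrite -complexIm -/(imC zeta) im0.
(* The countable family of conditions: discs [(c, k)] to be hit by the image, and
   pairs [(p, q)] to be separated. *)
pose G (i : (rat * rat) * nat + (rat * rat) * (rat * rat)) : set (Omega Lambda) :=
  match i with
  | inl (c, k) =>
    [set lam | exists2 z, U z & cabs (fser lam z - ratC R c) < k.+1%:R^-1]
  | inr (p, q) =>
    [set lam | [&& cabs (ratC R p) < 1, cabs (ratC R q) < 1 &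
       ratC R p != ratC R q] -> fser lam (ratC R p) != fser lam (ratC R q)]
  end.
apply: (@residual_bigcap _ _ G).
- case=> [[c k]|[p q]] /=; first exact: (open_hits LM).
  case: and3P => [[p1 q1 _]|_].
    rewrite (_ : [set lam | _] =
        [set lam | fser lam (ratC R p) != fser lam (ratC R q)]).
      exact: (open_separates LM).
    by apply/seteqP; split=> lam /= H; [exact: H|move=> _].
  by rewrite (_ : [set lam | _] = setT); [exact: openT|apply/seteqP; split].
- case=> [[c k]|[p q]] /=.
    have k0 : 0 < k.+1%:R^-1 :> R by rewrite invr_gt0 ltr0n.
    exact: (dense_hits LM _ U_disk La Lb ab zeta_circle imz zeta_acc k0).
  case: and3P => [[p1 q1 pq]|_].
    rewrite (_ : [set lam | _] =
        [set lam | fser lam (ratC R p) != fser lam (ratC R q)]).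
      exact: (dense_separates LM La Lb ab).
    by apply/seteqP; split=> lam /= H; [exact: H|move=> _].
  rewrite (_ : [set lam | _] = setT); last by apply/seteqP; split.
  by move=> O [x Ox] _; exists x.
move=> lam GA; split.
  move=> O [y Oy] /openC_cabsP/(_ y Oy)[e e0 eO].
  have [k] : exists k : nat, 0 + k.+1%:R^-1 < e / 2.
    by apply: ltr_add_invr; rewrite divr_gt0.
  rewrite add0r => ke; have k0 : 0 < k.+1%:R^-1 :> R by rewrite invr_gt0 ltr0n.
  have [c cy] := rat_near y k0; have [z Uz zc] := GA (inl (c, k)).
  exists (fser lam z); split; last by exists z.
  apply: eO; apply: le_lt_trans (cabs_triangle (ratC R c) (fser lam z) y) _.
  rewrite [ltRHS]splitr ltrD //; [exact: lt_trans zc ke|exact: lt_trans cy ke].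
apply/openC_cabsP => _ [w Uw <-].
have [r r0 rU] := (openC_cabsP U).1 U_open w Uw.
have UD z : U z -> cabs z < 1 by move=> /U_disk; exact: unit_disk_cabs.
have nc z : cabs z < 1 -> nonconstant_near (digits lam) z.
  apply: separates_nonconstant => p q p1 q1 pq.
  by apply: (GA (inr (p, q))); rewrite p1 q1.
have [e e0 He] := pser_open_at (digits_le LM lam) r0 (fun z zr => UD z (rU z zr)) nc.
exists e => // v; rewrite fserE => /He[z zr zv].
by exists z => //; exact: rU.
Qed.
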